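(* Let $K$ be a field, let $0<a<b<c$ be integers, let $m\ge0$ be an integer, and let $I=(x^{c+m},\,x^{b+m}y^{a+m},\,x^{a+m}y^{b+m},\,y^{c+m})\subset K[x,y]$ be the symmetric ideal attached to the sequence $0<a+m<b+m<c+m$. Then the fiber cone $F(I)$ is Cohen--Macaulay for all $m\ge c-2a$.
   Context: With $\mathfrak m=(x,y)\subset K[x,y]$, the fiber cone of $I$ is the standard graded $K$-algebra $F(I)=\bigoplus_{k\ge0}I^k/\mathfrak mI^k$. The symmetric ideal attached to integers $0<a<b<c$ is $(x^c,x^by^a,x^ay^b,y^c)$. *)

(* Defs.v *)
From HB Require Import structures.
From mathcomp Require Import all_boot all_algebra.
From mathcomp Require Import boolp classical_sets.
From mathcomp Require Import mpoly.

Set Implicit Arguments.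
Unset Strict Implicit.
Unset Printing Implicit Defensive.

Import GRing.Theory.

Local Open Scope ring_scope.

Section Ideals.
Variable R : comNzRingType.
Implicit Types (S T I : set R) (a b c x y : R).

(* Not required to be proper. *)
Definition is_ideal I : Prop :=
  [/\ I 0, forall x y, I x -> I y -> I (x + y) & forall a x, I x -> I (a * x)].

Definition ideal_span S : set R := smallest is_ideal S.

Definition ideal_mul S T : set R :=
  ideal_span (fun z => exists x y, [/\ S x, T y & z = x * y]).

Fixpoint ideal_pow S (k : nat) : set R :=
  if k is k1.+1 then ideal_mul S (ideal_pow S k1) else setT.

Definition is_prime_ideal P : Prop :=
  [/\ is_ideal P, ~ P 1 & forall x y, P (x * y) -> P x \/ P y].

Definition prime_chain (d : nat) (P : 'I_d.+1 -> set R) : Prop :=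
  (forall i, is_prime_ideal (P i)) /\
  (forall i j : 'I_d.+1, (i < j)%N -> (P i `<` P j)%classic).

Definition krull_dim (d : nat) : Prop :=
  (exists P : 'I_d.+1 -> set R, prime_chain P) /\
  (forall (e : nat) (P : 'I_e.+1 -> set R), prime_chain P -> (e <= d)%N).

Definition regular_sequence (s : seq R) : Prop :=
  (forall i : nat, (i < size s)%N -> forall z,
     let J := ideal_span (fun x => x \in take i s) in J (s`_i * z) -> J z) /\
  ~ ideal_span (fun x => x \in s) 1.

(* The maximal length of a regular sequence contained in M. *)
Definition depth_in (M : set R) (d : nat) : Prop :=
  (exists s, [/\ regular_sequence s, forall x, x \in s -> M x & size s = d]) /\
  (forall s, regular_sequence s -> (forall x, x \in s -> M x) ->
     (size s <= d)%N).

(* To be used when R is a standard graded algebra over a field with graded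
   maximal ideal M; such an R is Noetherian and depth R means depth with
   respect to M. *)
Definition graded_cohen_macaulay (M : set R) : Prop :=
  exists d, krull_dim d /\ depth_in M d.

Lemma ideal_span_ideal S : is_ideal (ideal_span S).
Proof.
split=> [J [[J0 _ _] _] //|x y Sx Sy J JS|a x Sx J JS].
- by case: (JS) => -[_ JD _] _; apply: JD; [exact: Sx|exact: Sy].
- by case: (JS) => -[_ _ JM] _; apply: JM; exact: Sx.
Qed.

Lemma ideal_mul_ideal S T : is_ideal (ideal_mul S T).
Proof. exact: ideal_span_ideal. Qed.

Lemma ideal_pow_ideal S k : is_ideal (ideal_pow S k).
Proof. by case: k => [|k]; [split|exact: ideal_mul_ideal]. Qed.

Lemma ideal_sum I (J : Type) (r : seq J) (P : pred J) (F : J -> R) :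
  is_ideal I -> (forall j, P j -> I (F j)) -> I (\sum_(j <- r | P j) F j).
Proof. by case=> I0 ID _ IF; apply: big_ind. Qed.

Lemma idealB I x y : is_ideal I -> I x -> I y -> I (x - y).
Proof. by case=> _ ID IM Ix Iy; apply: ID => //; rewrite -mulN1r; apply: IM. Qed.

Lemma ideal_mul_mem S T x y : S x -> T y -> ideal_mul S T (x * y).
Proof. by move=> Sx Ty; apply: sub_gen_smallest; exists x, y. Qed.

Lemma ideal_span_le S I : is_ideal I -> (forall x, S x -> I x) ->
  forall x, ideal_span S x -> I x.
Proof. by move=> II SI x; apply; split. Qed.

Lemma ideal_powD S i j x y :
  ideal_pow S i x -> ideal_pow S j y -> ideal_pow S (i + j) (x * y).
Proof.
elim: i x => [|i IH] x /= Sx Sy; first by have [_ _] := ideal_pow_ideal S j; apply.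
have [H0 HD HM] := ideal_mul_ideal S (ideal_pow S (i + j)).
apply: (@ideal_span_le _ (fun x => ideal_mul S (ideal_pow S (i + j)) (x * y)))
  Sx => [|_ [u [v [Su Sv ->]]]].
- split=> [|u v Hu Hv|a u Hu]; rewrite ?mul0r ?mulrDl -?mulrA //.
  + exact: HD.
  + exact: HM.
- by rewrite -mulrA; apply: ideal_mul_mem => //; apply: IH.
Qed.

Lemma ideal_mul_pow_absorb S T i j x y : is_ideal T ->
  ideal_pow S i x -> ideal_mul T (ideal_pow S j) y ->
  ideal_mul T (ideal_pow S (i + j)) (x * y).
Proof.
move=> TI Sx Ty.
have [H0 HD HM] := ideal_mul_ideal T (ideal_pow S (i + j)).
apply: (@ideal_span_le _ (fun y => ideal_mul T (ideal_pow S (i + j)) (x * y)))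
  Ty => [|_ [u [v [Tu Sv ->]]]].
- split=> [|u v Hu Hv|a u Hu]; rewrite ?mulr0 ?mulrDr //; first exact: HD.
  by rewrite mulrCA; apply: HM.
- by rewrite mulrCA; apply: ideal_mul_mem => //; apply: ideal_powD.
Qed.

End Ideals.

(* The Rees algebra: the polynomials in t over R with k-th coefficient in I^k,
   that is, the direct sum of the I^k t^k. *)
Section Rees.
Variables (R : comNzRingType) (I : set R).

Definition rees_pred : {pred {poly R}} :=
  fun p => `[< forall k, ideal_pow I k p`_k >].

Lemma rees_subring : subring_closed rees_pred.
Proof.
split=> [|p q /asboolP Ip /asboolP Iq|p q /asboolP Ip /asboolP Iq].
- apply/asboolP => -[|k]; rewrite coef1 //=.
  by have [] := ideal_pow_ideal I k.+1.
- by apply/asboolP => k; rewrite coefB; apply: idealB (ideal_pow_ideal I k) _ _.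
- apply/asboolP => k; rewrite coefM; apply: ideal_sum (ideal_pow_ideal I k) _.
  by move=> i _; rewrite -[X in ideal_pow _ X](subnKC (leq_ord i));
    apply: ideal_powD.
Qed.

HB.instance Definition _ := GRing.isSubringClosed.Build {poly R} rees_pred
  rees_subring.

Record rees := Rees { rees_val :> {poly R}; _ : rees_val \in rees_pred }.

HB.instance Definition _ := [isSub for rees_val].
HB.instance Definition _ := [Choice of rees by <:].
HB.instance Definition _ := [SubChoice_isSubComNzRing of rees by <:].

End Rees.

Definition max_ideal_xy (K : fieldType) : set {mpoly K[2]} :=
  ideal_span (fun p => p \in [:: 'X_ord0; 'X_ord_max]).

Arguments max_ideal_xy K : clear implicits.

Section FiberCone.
Variables (K : fieldType) (I : set {mpoly K[2]}).

(* The sum of the m I^k t^k. *)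
Definition fiber_ideal : {pred rees I} :=
  fun p => `[< forall k, ideal_mul (max_ideal_xy K) (ideal_pow I k) (rees_val p)`_k >].

Lemma max_ideal_xy_eval0 (p : {mpoly K[2]}) : max_ideal_xy K p -> p.@[fun _ => 0] = 0.
Proof.
apply: (@ideal_span_le _ _ (fun p => p.@[fun _ => 0] = 0)) => [|q].
  split=> [|x y Hx Hy|a x Hx]; first by rewrite meval0.
  - by rewrite mevalD Hx Hy addr0.
  - by rewrite mevalM Hx mulr0.
by rewrite !inE => /orP[]/eqP->; rewrite mevalXU.
Qed.

Lemma fiber_ideal_closed : idealr_closed fiber_ideal.
Proof.
set m := max_ideal_xy K; have mI : is_ideal m by exact: ideal_span_ideal.
split=> [||a p q].
- by apply/asboolP => k; rewrite coef0; have [] := ideal_mul_ideal m (ideal_pow I k).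
- apply/negP => /asboolP/(_ 0%N); rewrite coef1 /= => m1.
  have : m 1.
    apply: ideal_span_le m1 => // _ [x [y [mx _ ->]]].
    by rewrite mulrC; have [_ _] := mI; apply.
  by move/max_ideal_xy_eval0; rewrite meval1 => /eqP; rewrite oner_eq0.
- move=> /asboolP mp /asboolP mq; have /asboolP Ia : rees_val a \in rees_pred I.
    by case: a.
  apply/asboolP => k; rewrite coefD coefM.
  have [H0 HD HM] := ideal_mul_ideal m (ideal_pow I k).
  apply: (HD) => //; apply: ideal_sum (ideal_mul_ideal _ _) _ => i _.
  rewrite -[X in ideal_pow _ X](subnKC (leq_ord i)).
  exact: ideal_mul_pow_absorb.
Qed.

HB.instance Definition _ := isIdealr.Build (rees I) fiber_ideal
  fiber_ideal_closed.

(* The quotient of the sum of the I^k t^k by the sum of the m I^k t^k, whose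
   component of degree k is I^k / m I^k. *)
Definition fiber_cone := {ideal_quot fiber_ideal}.

HB.instance Definition _ := GRing.ComNzRing.on fiber_cone.

(* The graded maximal ideal of the fiber cone: its elements with zero
   component in degree 0. *)
Definition fiber_cone_max : set fiber_cone :=
  fun z => exists p : rees I,
    (rees_val p)`_0 = 0 /\ z = (\pi_(fiber_cone) p)%qT.

End FiberCone.

Definition symmetric_ideal (K : fieldType) (a b c : nat) : set {mpoly K[2]} :=
  let x : {mpoly K[2]} := 'X_ord0 in
  let y : {mpoly K[2]} := 'X_ord_max in
  ideal_span (fun p =>
    p \in [:: x ^+ c; x ^+ b * y ^+ a; x ^+ a * y ^+ b; y ^+ c]).

Arguments symmetric_ideal K a b c : clear implicits.

(* Main.v *)
Require Import Defs.
From HB Require Import structures.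
From mathcomp Require Import all_boot all_algebra.
From mathcomp Require Import boolp classical_sets.
From mathcomp Require Import mpoly.
From mathcomp Require Import ring zify.

(** Write I for the ideal attached to 0 < a < b < c, where c <= 2a (for the
    exponents shifted by m this is the hypothesis c <= m + 2a).  Let z0, e1,
    e2, z3 be the classes in the fiber cone F of the generators x^c, x^b y^a,
    x^a y^b, y^c, placed in degree 1.

    Since c <= 2a, each product of two of the two middle generators is a
    multiple of x^c y^c by a monomial other than 1, hence lies in m I^2; so
    e1^2 = e1 e2 = e2^2 = 0 and F is spanned by 1, e1, e2 over the image of
    S = K[z0, z3].  The monomials x^(ic) y^(jc) with i + j = k, together with
    their products by a middle generator for i + j = k - 1, have pairwise
    different x-exponents, and none of them is properly divisible by another
    monomial of I^k (corner_minimal).  Hence they are independent modulo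
    m I^k (corners_free), and F is the free S-module on 1, e1, e2: a
    square-zero extension of a polynomial ring in two variables, which is
    Cohen-Macaulay of dimension 2 with regular sequence z0, z3
    (free_square_zero_cohen_macaulay).

    The equality of dimension and depth is obtained from one elementary
    principle.  Let J0, J1, J2, J3 be an increasing chain of ideals such that
    Ji contains an element xi which is regular modulo J(i-1), for i = 1, 2, 3.
    If Q(x1, x2, x3) = 0 for a nonzero polynomial Q over K, then J3 is the
    unit ideal: divide by the power of x1 occurring in the lowest term of Q
    and reduce modulo J1, do the same with x2 and x3, and a nonzero constant
    remains (dependent3_chain).  A chain of four primes and a regular sequence
    of length three both give such ideals.  As any three elements of F satisfy
    a relation Q -- by counting dimensions in S, then squaring to kill the
    nilpotent part -- both the dimension and the depth are at most 2. *)

Set Implicit Arguments.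
Unset Strict Implicit.
Unset Printing Implicit Defensive.

Import GRing.Theory.

Local Open Scope ring_scope.

(** * Evaluation of polynomials along a ring morphism *)

Section Evaluation.
Variables (A R : comNzRingType) (f : {rmorphism A -> R}) (x : R).

Definition peval : {poly A} -> R := horner_morph (fun a : A => mulrC x (f a)).

HB.instance Definition _ := GRing.RMorphism.on peval.

Lemma pevalX : peval 'X = x.
Proof. exact: horner_morphX. Qed.

Lemma pevalC (a : A) : peval a%:P = f a.
Proof. exact: horner_morphC. Qed.

Lemma pevalE n (p : {poly A}) : (size p <= n)%N ->
  peval p = \sum_(i < n) f p`_i * x ^+ i.
Proof.
move=> le_pn; have {1}-> : p = \poly_(i < n) p`_i.
  apply/polyP => i; rewrite coef_poly; case: ltnP => // le_ni.
  by rewrite nth_default // (leq_trans le_pn).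
rewrite poly_def rmorph_sum /=; apply: eq_bigr => i _.
by rewrite -mul_polyC rmorphM rmorphXn /= pevalX pevalC.
Qed.

(** Splitting off the lowest power of the variable leaves a polynomial with
    nonzero constant term q; h is the value of the rest of the quotient. *)
Lemma peval_lowest (Q : {poly A}) : Q != 0 ->
  exists m q h, q != 0 /\ peval Q = x ^+ m * (f q + x * h).
Proof.
elim/poly_ind: Q => [|Q c IH]; first by rewrite eqxx.
have [->|c0] := eqVneq c 0.
  rewrite addr0 => QX0; have /IH[m [q [h [q0 eQ]]]] : Q != 0.
    by apply: contraNneq QX0 => ->; rewrite mul0r.
  by exists m.+1, q, h; split=> //; rewrite rmorphM /= pevalX eQ exprS; ring.
move=> _; exists 0%N, c, (peval Q); split=> //.
by rewrite rmorphD rmorphM /= pevalX pevalC expr0; ring.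
Qed.

End Evaluation.

(** * Algebraic dependence bounds prime chains and regular sequences *)

Section Ideals.
Variable R : comNzRingType.
Implicit Types (J : set R).

Definition regular_mod J x := forall z, J (x * z) -> J z.

Lemma regular_modX J x n z : regular_mod J x -> J (x ^+ n * z) -> J z.
Proof.
by move=> rx; elim: n => [|n IH]; rewrite ?mul1r // exprS -mulrA => /rx.
Qed.

(** Eliminates one variable: if f(Q)(x) lies in J, dividing by the lowest power
    of x, which is regular modulo J, and reducing modulo x puts the value of a
    nonzero polynomial in one variable less into J'. *)
Lemma regular_mod_peval (A : comNzRingType) (f : {rmorphism A -> R}) J J' x Q :
  is_ideal J' -> (forall z, J z -> J' z) -> J' x -> regular_mod J x ->
  Q != 0 -> J (peval f x Q) -> exists2 q, q != 0 & J' (f q).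
Proof.
move=> idJ' sJ J'x rx /(@peval_lowest _ _ f x)[m [q [h [q0 ->]]]].
move=> /(regular_modX rx)/sJ Jqh; exists q => //.
rewrite -(addrK (x * h) (f q)); apply: idealB => //.
by case: idJ' => _ _ IM; rewrite mulrC; apply: IM.
Qed.

End Ideals.

Section Dependence.
Variables (K : fieldType) (R : comNzRingType) (k : {rmorphism K -> R}).

(** The outermost variable is evaluated at x, so the lowest terms of a
    polynomial are taken first with respect to x. *)
Definition peval3 (x y z : R) : {poly {poly {poly K}}} -> R :=
  peval (peval (peval k z) y) x.

HB.instance Definition _ x y z := GRing.RMorphism.on (peval3 x y z).

Definition dependent3 (x y z : R) : Prop :=
  exists2 Q, Q != 0 & peval3 x y z Q = 0.

(** One variable disappears at each step of the chain; what is left at the end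
    is a nonzero constant of the field K. *)
Lemma dependent3_chain (J0 J1 J2 J3 : set R) x y z :
  dependent3 x y z ->
  is_ideal J0 -> is_ideal J1 -> is_ideal J2 -> is_ideal J3 ->
  (forall u, J0 u -> J1 u) -> (forall u, J1 u -> J2 u) ->
  (forall u, J2 u -> J3 u) ->
  J1 x -> J2 y -> J3 z ->
  regular_mod J0 x -> regular_mod J1 y -> regular_mod J2 z -> J3 1.
Proof.
move=> [Q Q0 eQ] i0 i1 i2 i3 s01 s12 s23 Jx Jy Jz rx ry rz.
have J0Q : J0 (peval3 x y z Q) by rewrite eQ; case: i0.
have [Q1 Q10 J1Q] := regular_mod_peval i1 s01 Jx rx Q0 J0Q.
have [Q2 Q20 J2Q] := regular_mod_peval i2 s12 Jy ry Q10 J1Q.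
have [c c0 J3c] := regular_mod_peval i3 s23 Jz rz Q20 J2Q.
by rewrite -(rmorph1 k) -(mulVf c0) rmorphM; case: i3 => _ _; apply.
Qed.

(** A prime is its own set of zero divisors modulo itself, so the elements of
    P(i+1) outside P(i) are regular modulo P(i). *)
Lemma dependent3_prime_chain e (P : 'I_e.+1 -> set R) :
  (forall x y z, dependent3 x y z) -> prime_chain P -> (e <= 2)%N.
Proof.
move=> dep [primeP ltP]; rewrite leqNgt; apply/negP => lt2e.
pose i n : 'I_e.+1 := inord n.
have iE n : (n <= 3)%N -> i n = n :> nat by move=> le_n3; rewrite inordK; lia.
have step n : (n < 3)%N -> [/\ forall u, P (i n) u -> P (i n.+1) u
    & exists2 x, P (i n.+1) x & regular_mod (P (i n)) x].
  move=> n3; have /ltP[sP] : (i n < i n.+1)%N by rewrite !iE //; lia.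
  move=> /existsNP[x /not_implyP[Px nPx]].
  split=> //; exists x => // z.
  by case: (primeP (i n)) => _ _ pP /pP[].
have [s01 [x Px rx]] := step 0%N isT.
have [s12 [y Py ry]] := step 1%N isT.
have [s23 [z Pz rz]] := step 2%N isT.
have idP n : is_ideal (P (i n)) by case: (primeP (i n)).
have [_ + _] := primeP (i 3).
by apply; apply: (dependent3_chain (dep x y z)) s01 s12 s23 _ _ _ rx ry rz.
Qed.

Lemma dependent3_regular_sequence (s : seq R) :
  (forall x y z, dependent3 x y z) -> regular_sequence s -> (size s <= 2)%N.
Proof.
move=> dep [reg prop]; rewrite leqNgt; apply/negP => lt2s; apply: prop.
pose J n := ideal_span (fun x => x \in take n s).
have idJ n : is_ideal (J n) by exact: ideal_span_ideal.
have sJ m n : (m <= n)%N -> forall u, J m u -> J n u.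
  move=> le_mn; apply: ideal_span_le => // x xs; apply: sub_gen_smallest.
  by move: xs; rewrite -(subnKC le_mn) /= takeD mem_cat => ->.
have Js n : (n < size s)%N -> J n.+1 s`_n.
  move=> n_s; apply: sub_gen_smallest => /=.
  by rewrite (take_nth 0) // mem_rcons mem_head.
have Jr n : (n < size s)%N -> regular_mod (J n) s`_n by move=> /reg.
rewrite -[X in ideal_span (fun x => x \in X)]take_size; apply: (sJ 3) => //.
apply: (dependent3_chain (dep s`_0 s`_1 s`_2)
  (idJ 0%N) (idJ 1%N) (idJ 2%N) (idJ 3%N));
  by [exact: sJ | apply: Js; lia | apply: Jr; lia].
Qed.

End Dependence.

(** * Three polynomials in two variables are dependent *)
Section PlanePolynomials.
Variable K : fieldType.
Implicit Types g : {poly {poly K}}.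

(** The two degrees are bounded separately, which makes the polynomials of
    bidegree at most n a space with the (n + 1)^2 monomial coefficients as
    coordinates. *)
Definition bidegree_le n g :=
  (size g <= n.+1)%N /\ forall i, (size (g`_i)%R <= n.+1)%N.

Lemma bidegree_leW m n g : (m <= n)%N -> bidegree_le m g -> bidegree_le n g.
Proof.
move=> le_mn [sg sgi]; split=> [|i]; apply: leq_trans (_ : m.+1 <= _)%N => //.
Qed.

Lemma bidegree_le1 : bidegree_le 0 1.
Proof.
split=> [|i]; rewrite ?size_poly1 // coef1.
by case: eqP; rewrite ?size_poly1 ?size_poly0.
Qed.

Lemma bidegree_leM m n g h :
  bidegree_le m g -> bidegree_le n h -> bidegree_le (m + n) (g * h).
Proof.
move=> [sg sgi] [sh shi]; split=> [|i].
  by apply: leq_trans (size_polyMleq _ _) _; lia.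
rewrite coefM; apply: leq_trans (size_sum _ _ _) _; apply/bigmax_leqP => j _.
apply: leq_trans (size_polyMleq _ _) _.
by have := sgi j; have := shi (i - j)%N; lia.
Qed.

Lemma bidegree_leX d n g : bidegree_le d g -> bidegree_le (n * d) (g ^+ n).
Proof.
move=> dg; elim: n => [|n IH]; first exact: bidegree_le1.
by rewrite exprS mulSn; apply: bidegree_leM.
Qed.

Lemma bidegree_le_ex g : exists d, bidegree_le d g.
Proof.
exists (size g + \max_(i < size g) size (g`_i)%R)%N; split=> [|i]; first by lia.
case: (ltnP i (size g)) => [ig|/(nth_default 0)->]; last by rewrite size_poly0.
have := leq_bigmax (F := fun i : 'I__ => size (g`_i)%R) (Ordinal ig).
by move=> /=; lia.
Qed.

Definition const2 : {rmorphism K -> {poly {poly K}}} := polyC \o polyC.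

(** More vectors than coordinates: the rows of the matrix of coefficients have a
    nontrivial linear relation. *)
Lemma bidegree_dependent (T : finType) n (F : T -> {poly {poly K}}) :
  (forall e, bidegree_le n (F e)) -> (n.+1 ^ 2 < #|T|)%N ->
  exists q : T -> K, (exists e, q e != 0) /\ \sum_e const2 (q e) * F e = 0.
Proof.
move=> degF ltT; pose C := ('I_n.+1 * 'I_n.+1)%type.
pose M := \matrix_(r < #|T|, s < #|{: C}|)
  (F (enum_val r))`_(enum_val s).1`_(enum_val s).2.
have /rowV0Pn[v /sub_kermxP vM /rV0Pn[r vr]] : kermx M != 0.
  rewrite kermx_eq0 /row_free neq_ltn (leq_ltn_trans (rank_leq_col _)) //.
  by rewrite card_prod !card_ord mulnn.
exists (fun e => v 0 (enum_rank e)); split.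
  by exists (enum_val r); rewrite enum_valK.
set S := \sum_e _; have [dS dSi] : bidegree_le n S.
  rewrite /S; split=> [|i].
    apply: leq_trans (size_sum _ _ _) _; apply/bigmax_leqP => e _.
    rewrite mul_polyC; apply: leq_trans (size_scale_leq _ _) _.
    by case: (degF e).
  rewrite coef_sum; apply: leq_trans (size_sum _ _ _) _.
  apply/bigmax_leqP => e _; rewrite coefCM mul_polyC.
  by apply: leq_trans (size_scale_leq _ _) _; case: (degF e).
apply/polyP => i; apply/polyP => j; rewrite !coef0.
case: (ltnP i n.+1) => [lt_in|le_ni]; last first.
  by rewrite [S`_i]nth_default ?coef0 // (leq_trans dS).
case: (ltnP j n.+1) => [lt_jn|le_nj]; last first.
  by rewrite nth_default // (leq_trans (dSi i)).
have /matrixP/(_ 0 (enum_rank (Ordinal lt_in, Ordinal lt_jn))) := vM.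
rewrite !mxE => eS; rewrite -[RHS]eS /S !coef_sum.
rewrite (reindex_onto enum_val enum_rank) /=; last first.
  by move=> e _; rewrite enum_rankK.
apply: eq_big => [r'|r' _]; first by rewrite enum_valK eqxx.
by rewrite !mxE enum_rankK /= !coefCM enum_valK.
Qed.

(** The n^3 monomials x^i y^j z^l with i, j, l < n have bidegree at most 3nd,
    so they live in a space of dimension (3nd + 1)^2, which is only quadratic
    in n. *)
Lemma plane_dependent3 x y z : dependent3 const2 x y z.
Proof.
have [d [dx dy dz]] :
    exists d, [/\ bidegree_le d x, bidegree_le d y & bidegree_le d z].
  have [[dx hx] [dy hy] [dz hz]] :=
    And3 (bidegree_le_ex x) (bidegree_le_ex y) (bidegree_le_ex z).
  exists (dx + dy + dz)%N.
  by split; [apply: bidegree_leW hx | apply: bidegree_leW hy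
            | apply: bidegree_leW hz]; lia.
(* With this n, (3nd + 1)^2 <= 16 n^2 d^2 + 1 is less than n^3. *)
pose n := (16 * d ^ 2).+2.
pose mon (e : 'I_n * 'I_n * 'I_n) := x ^+ e.1.1 * y ^+ e.1.2 * z ^+ e.2.
have mon_deg e : bidegree_le (3 * n * d) (mon e).
  case: e => -[i j] l; rewrite /mon /=.
  have := ltn_ord i; have := ltn_ord j; have := ltn_ord l => li lj ll.
  apply: (@bidegree_leW (i * d + j * d + l * d)); first by nia.
  by apply: bidegree_leM; [apply: bidegree_leM|]; apply: bidegree_leX.
have [|q [[e qe] eq0]] := bidegree_dependent mon_deg.
  have nE : n = (16 * (d * d) + 2)%N by rewrite /n; lia.
  rewrite !card_prod !card_ord -mulnn; move: nE; clearbody n => nE.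
  have le_d : (d <= d * d)%N by case: (d) => // d0; nia.
  have : (n * d <= n * n * (d * d))%N.
    by rewrite -mulnA leq_mul // (leq_trans le_d) // leq_pmull // nE; lia.
  by rewrite [X in (_ < _ * X)%N]nE; nia.
pose Q : {poly {poly {poly K}}} :=
  \poly_(i < n) \poly_(j < n) \poly_(l < n) q (inord i, inord j, inord l).
have QE (i j l : 'I_n) : Q`_i`_j`_l = q (i, j, l).
  by rewrite !(coef_poly, ltn_ord, inord_val).
exists Q.
  apply: contraNneq qe => Q0; have := QE e.1.1 e.1.2 e.2.
  by rewrite Q0 !coef0 -!surjective_pairing => <-.
rewrite -eq0.
transitivity (\sum_i \sum_j \sum_l const2 (q (i, j, l)) * mon (i, j, l)).
  rewrite /peval3 (@pevalE _ _ _ _ n) ?size_poly //; apply: eq_bigr => i _ /=.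
  have sQ : (size (Q`_i)%R <= n)%N by rewrite coef_poly ltn_ord size_poly.
  rewrite (@pevalE _ _ _ _ n) // mulr_suml; apply: eq_bigr => j _ /=.
  have sQ' : (size (Q`_i`_j)%R <= n)%N.
    by rewrite !(coef_poly, ltn_ord) size_poly.
  rewrite (@pevalE _ _ _ _ n) // !mulr_suml; apply: eq_bigr => l _.
  by rewrite QE /mon /=; ring.
by rewrite !pair_bigA; apply: eq_bigr => -[[i j] l].
Qed.

End PlanePolynomials.

(** * Square-zero extensions *)
Section SquareZeroExtension.
Variables (S R : comNzRingType) (f : {rmorphism S -> R}) (N : set R).
(* These hypotheses say that R is the direct sum of the subring f S, with f
   injective, and of the square-zero ideal N. *)
Hypotheses (idN : is_ideal N) (N_sqr0 : forall u, N u -> u * u = 0).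
Hypotheses (f_surj : forall r, exists g, N (r - f g)).
Hypotheses (f_inj : forall g, N (f g) -> g = 0).

(** Evaluation only depends modulo N on the point and on the coefficients; the
    morphism h' is kept apart from f composed with h so that the lemma can be
    iterated over the variables. *)
Lemma peval_congr (A : comNzRingType) (h : {rmorphism A -> S})
    (h' : {rmorphism A -> R}) x x' :
  N (x' - f x) -> (forall a, N (h' a - f (h a))) ->
  forall Q, N (peval h' x' Q - f (peval h x Q)).
Proof.
case: idN => N0 ND NM Nx Nh; elim/poly_ind => [|Q c IH].
  by rewrite !rmorph0 subrr.
rewrite !rmorphD !rmorphM /= !pevalX !pevalC.
have -> : peval h' x' Q * x' + h' c - (f (peval h x Q) * f x + f (h c)) =
  peval h' x' Q * (x' - f x) + f x * (peval h' x' Q - f (peval h x Q)) +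
  (h' c - f (h c)) by ring.
by apply: (ND) => //; apply: ND; apply: NM.
Qed.

(** A relation Q between the components in S has its value in N on the elements
    themselves, hence Q^2 is a relation between them. *)
Lemma dependent3_extension (K : fieldType) (k : {rmorphism K -> S}) :
  (forall x y z, dependent3 k x y z) ->
  forall x y z, dependent3 (f \o k) x y z.
Proof.
move=> dep x y z.
have [[x' Nx] [y' Ny] [z' Nz]] := And3 (f_surj x) (f_surj y) (f_surj z).
have [Q Q0 eQ] := dep x' y' z'; exists (Q * Q); first by rewrite mulf_neq0.
rewrite rmorphM; apply: N_sqr0.
rewrite /= -[peval3 _ _ _ _ _]subr0 -(rmorph0 f) -eQ.
do 3![apply: peval_congr => // ?].
by rewrite subrr; case: idN.
Qed.

Definition extend_ideal (p : set S) : set R :=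
  fun r => exists2 g, p g & N (r - f g).

Lemma extend_ideal_inj p g : extend_ideal p (f g) -> p g.
Proof.
by case=> h ph; rewrite -rmorphB => /f_inj/eqP; rewrite subr_eq0 => /eqP->.
Qed.

Lemma extend_ideal_mem (p : set S) g : p g -> extend_ideal p (f g).
Proof. by exists g => //; rewrite subrr; case: idN. Qed.

Lemma extend_ideal_prime p : is_prime_ideal p -> is_prime_ideal (extend_ideal p).
Proof.
case: idN => N0 ND NM [[p0 pD pM] p1 pP].
have congrM r g s h : N (r - f g) -> N (s - f h) -> N (r * s - f (g * h)).
  move=> Nr Ns; rewrite rmorphM.
  have -> : r * s - f g * f h = r * (s - f h) + f h * (r - f g) by ring.
  by apply: ND; apply: NM.
split.
- split=> [|r s [g pg Ng] [h ph Nh]|r s [h ph Nh]].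
  + by exists 0; rewrite ?rmorph0 ?subrr.
  + exists (g + h); first exact: pD.
    by rewrite rmorphD opprD addrACA; apply: ND.
  + by have [g Ng] := f_surj r; exists (g * h); [apply: pM|apply: congrM].
- by rewrite -(rmorph1 f) => /extend_ideal_inj.
- move=> r s [l pl Nl].
  have [[g Ng] [h Nh]] := (f_surj r, f_surj s).
  have egh : g * h = l.
    apply/eqP; rewrite -subr_eq0; apply/eqP/f_inj.
    have -> : f (g * h - l) = (r * s - f l) - (r * s - f (g * h)).
      by rewrite rmorphB; ring.
    by apply: idealB => //; apply: congrM.
  by move: pl; rewrite -egh => /pP[pg|ph]; [left; exists g|right; exists h].
Qed.

Lemma extend_prime_chain d (p : 'I_d.+1 -> set S) :
  prime_chain p -> prime_chain (fun i => extend_ideal (p i)).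
Proof.
move=> [primep ltp]; split=> [i|i j /ltp[sp nsp]].
  exact: extend_ideal_prime.
split=> [r [g pg Ng]|sP]; first by exists g => //; apply: sp.
by apply: nsp => g pg; apply: extend_ideal_inj; apply/sP/extend_ideal_mem.
Qed.

End SquareZeroExtension.

(** * Free square-zero extensions of the polynomial ring in two variables *)
Section PlanePrimes.
Variable K : fieldType.

(** The flag formed by the zero ideal, the ideal of the outer variable, and the
    ideal of both variables. *)
Definition plane_flag (i : nat) : set {poly {poly K}} :=
  fun g => match i with 0 => g = 0 | 1 => g.[0] = 0 | _ => g.[0].[0] = 0 end.

Lemma plane_flag_prime i : is_prime_ideal (plane_flag i).
Proof.
have /eqP nz1 := oner_neq0 {poly K}; have /eqP nz1' := oner_neq0 {poly {poly K}}.
have /eqP nz1'' := oner_neq0 K.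
case: i => [|[|i]]; split=> //=; rewrite ?hornerE //; try split=> /=.
all: try by rewrite ?hornerE.
all: try by move=> g h; rewrite ?hornerE => -> ->; rewrite ?hornerE ?addr0.
all: try by move=> g h; rewrite ?hornerE => ->; rewrite ?hornerE ?mulr0.
all: by move=> g h; rewrite ?hornerE => /eqP; rewrite mulf_eq0 => /orP[]/eqP; tauto.
Qed.

Lemma plane_flag_chain : prime_chain (fun i : 'I_3 => plane_flag i).
Proof.
split=> [i|]; first exact: plane_flag_prime.
have lt01 : (plane_flag 0 `<` plane_flag 1)%classic.
  split=> [g -> //=|/(_ 'X)/=]; rewrite ?hornerE // => /(_ erefl)/eqP.
  by rewrite polyX_eq0.
have lt12 : (plane_flag 1 `<` plane_flag 2)%classic.
  split=> [g /= -> //=|/(_ 'Y)/=]; rewrite ?hornerE // => /(_ erefl)/eqP.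
  by rewrite polyX_eq0.
have lt02 : (plane_flag 0 `<` plane_flag 2)%classic.
  case: lt01 lt12 => s01 n10 [s12 _]; split; first by move=> g /s01/s12.
  by move=> s20; apply: n10 => g /s12/s20.
by case=> [[|[|[|i]]] ?] [[|[|[|j]]] ?].
Qed.

End PlanePrimes.

Section FreeModule.
Variables (K : fieldType) (R : comNzRingType).
Variables (f : {rmorphism {poly {poly K}} -> R}) (e1 e2 : R).

Let comb g0 g1 g2 := f g0 + f g1 * e1 + f g2 * e2.

Hypothesis comb_surj : forall r, exists g0 g1 g2, r = comb g0 g1 g2.
Hypothesis comb_inj : forall g0 g1 g2,
  comb g0 g1 g2 = 0 -> [/\ g0 = 0, g1 = 0 & g2 = 0].
Hypotheses (e11 : e1 * e1 = 0) (e12 : e1 * e2 = 0) (e22 : e2 * e2 = 0).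

Let N : set R := fun r => exists g1 g2, r = f g1 * e1 + f g2 * e2.

Let idN : is_ideal N.
Proof.
split=> [|_ _ [g1 [g2 ->]] [h1 [h2 ->]]|r _ [h1 [h2 ->]]].
- by exists 0, 0; rewrite rmorph0; ring.
- by exists (g1 + h1), (g2 + h2); rewrite !rmorphD; ring.
- have [g0 [g1 [g2 ->]]] := comb_surj r; exists (g0 * h1), (g0 * h2).
  rewrite /comb !rmorphM; ring: e11 e12 e22.
Qed.

Let N_sqr0 u : N u -> u * u = 0.
Proof. by case=> g1 [g2 ->]; ring: e11 e12 e22. Qed.

Let f_surj r : exists g, N (r - f g).
Proof.
have [g0 [g1 [g2 ->]]] := comb_surj r; exists g0, g1, g2.
by rewrite /comb; ring.
Qed.

Let f_inj g : N (f g) -> g = 0.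
Proof.
case=> g1 [g2 eg]; suff /comb_inj[] : comb g (- g1) (- g2) = 0 by [].
by rewrite /comb eg !rmorphN; ring.
Qed.

(** Over a free module both regularity statements are read on coordinates, where
    they say that the two variables form a regular sequence in S. *)
Lemma free_regular_sequence : regular_sequence [:: f 'X; f 'Y].
Proof.
split=> [[|[|//]] _ z /= Jz|].
- have {Jz} : f 'X * z = 0.
    apply: (@ideal_span_le R _ (fun u : R => u = 0) _ _ _ Jz) => [|x]; last by [].
    by split=> // [x y -> ->|x y ->]; rewrite ?addr0 ?mulr0.
  have [g0 [g1 [g2 ->]]] := comb_surj z => Xz.
  have : comb ('X * g0) ('X * g1) ('X * g2) = 0.
    by rewrite -Xz /comb !rmorphM; ring.
  have X0 g : 'X * g = 0 -> g = 0 :> {poly {poly K}}.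
    by move/eqP; rewrite mulf_eq0 polyX_eq0 => /eqP.
  case/comb_inj => /X0-> /X0-> /X0->.
  rewrite /comb rmorph0 !mul0r !addr0.
  by case: (ideal_span_ideal (fun x => x \in take 0 [:: f 'X; f 'Y])).
- have [w] : exists w, f 'Y * z = f 'X * w.
    apply: (@ideal_span_le R _ (fun u => exists w, u = f 'X * w) _ _ _ Jz) => [|x].
      split=> [|_ _ [x ->] [y ->]|x _ [y ->]]; first by exists 0; rewrite mulr0.
        by exists (x + y); rewrite mulrDr.
      by exists (x * y); rewrite mulrCA.
    by rewrite /= inE => /eqP->; exists 1; rewrite mulr1.
  have [g0 [g1 [g2 ->]]] := comb_surj z; have [h0 [h1 [h2 ->]]] := comb_surj w.
  move=> ezw.
  have : comb ('Y * g0 - 'X * h0) ('Y * g1 - 'X * h1) ('Y * g2 - 'X * h2) = 0.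
    move/eqP: ezw; rewrite -subr_eq0 => /eqP <-.
    by rewrite /comb !rmorphB !rmorphM; ring.
  have X_dvd g h :
      'Y * g - 'X * h = 0 -> exists q, g = 'X * q :> {poly {poly K}}.
    move/eqP; rewrite subr_eq0 => /eqP/(congr1 (horner^~ 0)).
    rewrite !hornerE => /eqP.
    rewrite mulf_eq0 polyX_eq0 /= => /factor_theorem[q ->].
    by exists q; rewrite subr0 mulrC.
  case/comb_inj => /X_dvd[q0 ->] /X_dvd[q1 ->] /X_dvd[q2 ->].
  have -> : comb ('X * q0) ('X * q1) ('X * q2) = comb q0 q1 q2 * f 'X.
    by rewrite /comb !rmorphM; ring.
  have [_ _] := ideal_span_ideal (fun x => x \in take 1 [:: f 'X; f 'Y]).
  by apply; apply: sub_gen_smallest; rewrite /= mem_head.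
- have [idP P1 _] := extend_ideal_prime idN f_surj f_inj (plane_flag_prime K 2).
  move=> /(ideal_span_le idP) s1; apply/P1/s1 => x.
  by rewrite !inE => /orP[]/eqP->; apply: (extend_ideal_mem f idN) => /=;
    rewrite !hornerE.
Qed.

Theorem free_square_zero_cohen_macaulay (M : set R) :
  M (f 'X) -> M (f 'Y) -> graded_cohen_macaulay M.
Proof.
move=> MX MY.
have dep := dependent3_extension idN N_sqr0 f_surj (@plane_dependent3 K).
exists 2%N; split; split.
- exists (fun i => extend_ideal f N (@plane_flag K i)).
  exact: extend_prime_chain (plane_flag_chain K).
- by move=> e P; apply: dependent3_prime_chain dep.
- exists [:: f 'X; f 'Y]; split=> // [|x]; first exact: free_regular_sequence.
  by rewrite !inE => /orP[]/eqP->.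
- by move=> s reg _; apply: dependent3_regular_sequence dep reg.
Qed.

End FreeModule.

(** * Generators of a fiber cone *)
Section FiberConeGenerators.
Variables (K : fieldType) (I : set {mpoly K[2]}).
Local Notation m := (max_ideal_xy K).
Local Notation F := (fiber_cone I).

(** The residue field of the maximal ideal m is K. *)
Lemma const_modm (p : {mpoly K[2]}) : exists c, m (p - c%:MP).
Proof.
have [m0 mD mM] : is_ideal m by exact: ideal_span_ideal.
have mX (i : 'I_2) : m 'X_i.
  apply: sub_gen_smallest; rewrite /= !inE.
  case: i => [[|[|//]] i2]; apply/orP; [left|right];
    by apply/eqP; congr 'X__; apply: val_inj.
elim/mpolyind: p => [|c u p _ _ [d pd]]; first by exists 0; rewrite subr0.
have [e ue] : exists e, m ('X_[u] - e%:MP).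
  rewrite mpolyXE_id big_ord_recl big_ord1.
  have mXn i n : exists e, m ('X_i ^+ n - e%:MP).
    case: n => [|n]; first by exists 1; rewrite expr0 subrr.
    by exists 0; rewrite subr0 exprSr; apply: mM.
  have [e1 me1] := mXn ord0 (u ord0).
  have [e2 me2] := mXn (lift ord0 ord0) (u (lift ord0 ord0)).
  exists (e1 * e2); rewrite mpolyCM.
  set A := _ ^+ _ in me1 *; set B := _ ^+ _ in me2 *.
  have -> : A * B - e1%:MP * e2%:MP =
    B * (A - e1%:MP) + e1%:MP * (B - e2%:MP) by ring.
  by apply: mD; apply: mM.
exists (c * e + d); rewrite mpolyCD mpolyCM -mul_mpolyC.
have -> : c%:MP * 'X_[u] + p - (c%:MP * e%:MP + d%:MP) =
  c%:MP * ('X_[u] - e%:MP) + (p - d%:MP) by ring.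
by apply: (mD) => //; apply: mM.
Qed.

(** The element u t^k, where u must be in I^k.  Making it total with default
    value 0 avoids carrying membership proofs inside terms. *)
Definition rees_term k (u : {mpoly K[2]}) : rees I := insubd 0 (u *: 'X^k).

Lemma rees_termE k u : ideal_pow I k u -> rees_val (rees_term k u) = u *: 'X^k.
Proof.
move=> Iu; rewrite /rees_term -[rees_val _]/(val _) val_insubd.
case: ifP => // /negP[].
apply/asboolP => l; rewrite coefZ coefXn; case: eqP => [->|_]; first by rewrite mulr1.
by rewrite mulr0; case: (ideal_pow_ideal I l).
Qed.

Lemma rees_termM k l u v : ideal_pow I k u -> ideal_pow I l v ->
  rees_term k u * rees_term l v = rees_term (k + l) (u * v).
Proof.
move=> Iu Iv; apply: val_inj; rewrite rmorphM /= !rees_termE //; last exact: ideal_powD.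
by rewrite -scalerAl -scalerAr scalerA exprD.
Qed.

Lemma rees_termD k u v : ideal_pow I k u -> ideal_pow I k v ->
  rees_term k (u + v) = rees_term k u + rees_term k v.
Proof.
move=> Iu Iv; apply: val_inj; rewrite rmorphD /= !rees_termE ?scalerDl //.
by case: (ideal_pow_ideal I k) => _ + _; apply.
Qed.

Lemma rees_coef (p : rees I) k : ideal_pow I k (rees_val p)`_k.
Proof. by case: p => p /= /asboolP. Qed.

Lemma rees_term_sum (p : rees I) :
  p = \sum_(k < size (rees_val p)) rees_term k (rees_val p)`_k.
Proof.
apply: val_inj; rewrite rmorph_sum /= -[LHS]coefK poly_def.
by apply: eq_bigr => k _; rewrite rees_termE //; apply: rees_coef.
Qed.

Definition fiber_pi : {rmorphism rees I -> F} := \pi_F%qT.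

Lemma fiber_pi_eq0 (p : rees I) :
  (forall k, ideal_mul m (ideal_pow I k) (rees_val p)`_k) <-> fiber_pi p = 0.
Proof.
have -> : (fiber_pi p = 0) <-> p \in @fiber_ideal K I; last by split=> /asboolP.
rewrite -[p in p \in _]subr0 Quotient.idealrBE -[in X in X <-> _](rmorph0 fiber_pi).
by split=> [e|/eqP/=]; [apply/eqP|].
Qed.

Lemma fiber_term_eq0 k u : ideal_mul m (ideal_pow I k) u ->
  fiber_pi (rees_term k u) = 0.
Proof.
move=> mu; have Iu : ideal_pow I k u.
  apply: ideal_span_le mu => [|_ [a [b [_ Ib ->]]]]; first exact: ideal_pow_ideal.
  by case: (ideal_pow_ideal I k) => _ _; apply.
apply/fiber_pi_eq0 => l; rewrite rees_termE // coefZ coefXn.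
case: eqP => [->|_]; rewrite ?mulr1 // mulr0.
by case: (ideal_mul_ideal m (ideal_pow I l)).
Qed.

Definition rees_const (c : K) : rees I := rees_term 0 c%:MP.

Lemma rees_const_is_zmod_morphism : zmod_morphism rees_const.
Proof.
move=> c d; apply: val_inj; rewrite rmorphB /= !rees_termE //=.
by rewrite mpolyCB scalerBl.
Qed.

Lemma rees_const_is_monoid_morphism : monoid_morphism rees_const.
Proof.
split=> [|c d]; apply: val_inj; rewrite ?rmorphM ?rmorph1 /= !rees_termE //=.
  by rewrite mpolyC1 scale1r expr0.
by rewrite mpolyCM !expr0 -scalerAl mul1r scalerA.
Qed.

HB.instance Definition _ :=
  GRing.isZmodMorphism.Build K (rees I) rees_const rees_const_is_zmod_morphism.
HB.instance Definition _ :=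
  GRing.isMonoidMorphism.Build K (rees I) rees_const rees_const_is_monoid_morphism.

Lemma rees_term1 : rees_term 0 1 = 1.
Proof. by apply: val_inj; rewrite rmorph1 /= rees_termE // scale1r expr0. Qed.

Lemma rees_termX k u n : ideal_pow I k u ->
  ideal_pow I (n * k) (u ^+ n) /\ rees_term k u ^+ n = rees_term (n * k) (u ^+ n).
Proof.
move=> Iu; elim: n => [|n [IHm IHe]]; first by split=> //; rewrite !expr0 rees_term1.
by rewrite !exprS IHe mulSn rees_termM //; split=> //; apply: ideal_powD.
Qed.

(** The fiber cone is the K-algebra generated by the classes in degree 1 of any
    generators of I.  For each k the polynomials u whose class in degree k lies
    in B form an ideal, because in degree 0 a polynomial has the class of its
    constant term; so it is enough to look at products of generators. *)
Lemma fiber_cone_generated (G : set {mpoly K[2]}) (B : set F) :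
  (forall u, I u <-> ideal_span G u) ->
  (forall x y, B x -> B y -> B (x + y)) ->
  (forall x y, B x -> B y -> B (x * y)) ->
  (forall c, B (fiber_pi (rees_const c))) ->
  (forall u, G u -> B (fiber_pi (rees_term 1 u))) ->
  forall x, B x.
Proof.
move=> IG BD BM Bc BG.
have B0 : B 0 by have := Bc 0; rewrite !rmorph0.
have B_poly (a : {mpoly K[2]}) : B (fiber_pi (rees_term 0 a)).
  have [c mac] := const_modm a.
  have -> : rees_term 0 a = rees_term 0 (a - c%:MP) + rees_const c.
    by rewrite /rees_const -rees_termD // subrK.
  rewrite rmorphD; apply: BD; rewrite // fiber_term_eq0 //=.
  by rewrite -[a - _]mulr1; apply: ideal_mul_mem.
have idT k : is_ideal (fun u => ideal_pow I k u /\ B (fiber_pi (rees_term k u))).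
  have [I0 ID IM] := ideal_pow_ideal I k.
  split=> [|u v [Iu Bu] [Iv Bv]|a u [Iu Bu]].
  - split=> //; rewrite fiber_term_eq0 //.
    by case: (ideal_mul_ideal m (ideal_pow I k)).
  - by split; [apply: ID|rewrite rees_termD // rmorphD; apply: BD].
  - split; first exact: IM.
    by rewrite -[k]add0n -rees_termM // rmorphM; apply: BM.
have B1 u : I u -> B (fiber_pi (rees_term 1 u)).
  have I1 v : I v -> ideal_pow I 1 v.
    by move=> Iv; rewrite -[v]mulr1; apply: ideal_mul_mem.
  move=> /IG Gu; suff: ideal_pow I 1 u /\ B (fiber_pi (rees_term 1 u)) by case.
  apply: (ideal_span_le (idT 1%N)) Gu => v Gv.
  by split=> /=; [apply: I1; apply/IG; apply: sub_gen_smallest|apply: BG].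
have Bk k u : ideal_pow I k u -> B (fiber_pi (rees_term k u)).
  elim: k u => [|k IH] u Iu; first exact: B_poly.
  suff: ideal_pow I k.+1 u /\ B (fiber_pi (rees_term k.+1 u)) by case.
  apply: (ideal_span_le (idT k.+1)) Iu => _ [v [w [Iv Iw ->]]].
  split; first exact: ideal_mul_mem.
  have I1 : ideal_pow I 1 v by rewrite -[v]mulr1; apply: ideal_mul_mem.
  rewrite -[k.+1]/(1 + k)%N -rees_termM // rmorphM.
  by apply: BM; [apply: B1|apply: IH].
move=> x; rewrite -[x]reprK -[\pi_F%qT (repr x)]/(fiber_pi (repr x)).
rewrite (rees_term_sum (repr x)) rmorph_sum /=; apply: big_ind => // k _.
exact/Bk/rees_coef.
Qed.

End FiberConeGenerators.

(** * Supports of bivariate polynomials *)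
Section BivariateMonomials.
Variable K : fieldType.
Implicit Types (f g : {mpoly K[2]}) (U V W : nat -> nat -> Prop).

Definition xy_exp (p q : nat) : 'X_{1..2} :=
  (U_(ord0) *+ p + U_(ord_max) *+ q)%MM.

Definition xy_mon p q : {mpoly K[2]} := 'X_ord0 ^+ p * 'X_ord_max ^+ q.

Lemma xy_exp0 p q : xy_exp p q ord0 = p.
Proof. by rewrite /xy_exp mnmDE !mulmnE !mnm1E /=; lia. Qed.

Lemma xy_exp_max p q : xy_exp p q ord_max = q.
Proof. by rewrite /xy_exp mnmDE !mulmnE !mnm1E /=; lia. Qed.

Lemma xy_monE p q : xy_mon p q = 'X_[xy_exp p q].
Proof. by rewrite /xy_exp mpolyXD -!mpolyXn. Qed.

Lemma xy_monM p q p' q' : xy_mon p q * xy_mon p' q' = xy_mon (p + p') (q + q').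
Proof. by rewrite /xy_mon !exprD; ring. Qed.

Lemma xy_monX p q n : xy_mon p q ^+ n = xy_mon (n * p) (n * q).
Proof. by rewrite /xy_mon exprMn -!exprM ![(_ * n)%N]mulnC. Qed.

Lemma mcoeff_xy_mon p q p' q' :
  (xy_mon p q)@_(xy_exp p' q') = ((p == p') && (q == q'))%:R.
Proof.
rewrite xy_monE mcoeffX; congr (nat_of_bool _)%:R.
apply/eqP/andP => [e|[/eqP-> /eqP->] //].
by rewrite -(xy_exp0 p q) -{2}(xy_exp_max p q) e xy_exp0 xy_exp_max.
Qed.

Definition supp_in U f :=
  forall u : 'X_{1..2}, u \in msupp f -> U (u ord0) (u ord_max).

Lemma supp_in_mon U p q : U p q -> supp_in U (xy_mon p q).
Proof.
move=> Upq u; rewrite xy_monE msuppX inE => /eqP->.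
by rewrite xy_exp0 xy_exp_max.
Qed.

Lemma supp_inM U V W f g :
  (forall p q p' q', U p q -> V p' q' -> W (p + p') (q + q'))%N ->
  supp_in U f -> supp_in V g -> supp_in W (f * g).
Proof.
move=> UVW Uf Vg u /msuppM_le/allpairsP[[v w] /= [vf wg ->]].
by rewrite !mnmDE; apply: UVW; [apply: Uf|apply: Vg].
Qed.

Lemma supp_in_ideal U : (forall p q p' q', U p q -> U (p + p') (q + q'))%N ->
  is_ideal (supp_in U).
Proof.
move=> Uup; split=> [u|f g Uf Ug u|f g Ug].
- by rewrite msupp0.
- by move/msuppD_le; rewrite mem_cat => /orP[/Uf|/Ug].
- rewrite mulrC; apply: (@supp_inM _ (fun _ _ => True)) Ug _ => //.
  by move=> p q p' q' Upq _; apply: Uup.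
Qed.

Lemma supp_in_coef0 U f p q : supp_in U f -> ~ U p q -> f@_(xy_exp p q) = 0.
Proof.
move=> Uf nU; apply/eqP; rewrite mcoeff_eq0; apply/negP => /Uf.
by rewrite xy_exp0 xy_exp_max.
Qed.

Lemma max_ideal_xy_supp f : max_ideal_xy K f -> supp_in (fun p q => 0 < p + q)%N f.
Proof.
apply: ideal_span_le => [|g]; first by apply: supp_in_ideal; lia.
rewrite !inE => /orP[]/eqP->.
  by rewrite -['X__]/('X_ord0 ^+ 1) -[_ ^+ 1]mulr1; apply: (@supp_in_mon _ 1 0).
by rewrite -['X__]/('X_ord_max ^+ 1) -[_ ^+ 1]mul1r; apply: (@supp_in_mon _ 0 1).
Qed.

Lemma xy_mon_max_ideal p q : (0 < p + q)%N -> max_ideal_xy K (xy_mon p q).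
Proof.
have [_ _ mM] : is_ideal (max_ideal_xy K) by exact: ideal_span_ideal.
have mx : max_ideal_xy K 'X_ord0 by apply: sub_gen_smallest; rewrite /= mem_head.
have my : max_ideal_xy K 'X_ord_max.
  by apply: sub_gen_smallest; rewrite /= !inE eqxx orbT.
case: p => [|p _]; last by rewrite /xy_mon exprSr mulrAC; apply: mM.
by case: q => [//|q] _; rewrite /xy_mon exprSr mulrA; apply: mM.
Qed.

End BivariateMonomials.

(** * The staircase of the powers of a symmetric ideal *)
Section Staircase.
Variables (a b c : nat).
Hypotheses (a_gt0 : (0 < a)%N) (lt_ab : (a < b)%N) (lt_bc : (b < c)%N).
Hypothesis le_c2a : (c <= 2 * a)%N.

(** The minimal generators of I^k are the corners of a staircase.  Each is
    x^(ic) y^(jc) times one of 1, x^b y^a, x^a y^b, which are encoded by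
    Power, XHeavy and YHeavy; the last two already use one factor from I. *)
Inductive corner_type := Power | XHeavy | YHeavy.

Definition corner_deg t : nat := match t with Power => 0 | _ => 1 end.
Definition corner_x t : nat :=
  match t with Power => 0 | XHeavy => b | YHeavy => a end.

Definition corner_y t : nat :=
  match t with Power => 0 | XHeavy => a | YHeavy => b end.

Definition staircase k p q : Prop := exists t i j,
  [/\ i + j + corner_deg t = k, i * c + corner_x t <= p
    & j * c + corner_y t <= q]%N.

Lemma staircase_up k p q p' q' : staircase k p q -> staircase k (p + p') (q + q').
Proof. by case=> t [i [j [ijk ip jq]]]; exists t, i, j; split=> //; lia. Qed.

Lemma corner_x_lt t : (corner_x t < c)%N. Proof. by case: t => /=; lia. Qed.

(** Multiplying two middle generators loses the corner structure: as c <= 2a,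
    the product is merely bounded below by the corner x^c y^c. *)
Lemma staircaseS k p q p' q' :
  (p, q) \in [:: (c, 0); (b, a); (a, b); (0, c)]%N ->
  staircase k p' q' -> staircase k.+1 (p + p') (q + q').
Proof.
move=> gen [t [i [j [<- ip jq]]]]; move: gen; rewrite !inE !xpair_eqE.
case/or4P=> /andP[/eqP-> /eqP->].
- by exists t, i.+1, j; split; lia.
- case: t ip jq => /= ip jq.
  + by exists XHeavy, i, j; split=> /=; lia.
  + by exists Power, i.+1, j.+1; split=> /=; lia.
  + by exists Power, i.+1, j.+1; split=> /=; lia.
- case: t ip jq => /= ip jq.
  + by exists YHeavy, i, j; split=> /=; lia.
  + by exists Power, i.+1, j.+1; split=> /=; lia.
  + by exists Power, i.+1, j.+1; split=> /=; lia.
- by exists t, i, j.+1; split; lia.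
Qed.

Lemma multiple_le i j r s :
  (r < c)%N -> (i * c + r <= j * c + s)%N -> (s < c)%N ->
  (i < j)%N || (i == j) && (r <= s)%N.
Proof.
move=> rc le_ij sc; case: (ltngtP i j) => //= [lt_ji|eq_ij]; last first.
  by move: le_ij; rewrite eq_ij leq_add2l.
have : (j.+1 * c <= i * c)%N by rewrite leq_mul2r lt_ji orbT.
by rewrite mulSn; lia.
Qed.

(** A corner below another one of the same degree k would need quotients by c
    of both exponents with too small a sum, unless the two coincide. *)
Lemma corner_minimal t i j p q :
  staircase (i + j + corner_deg t) p q ->
  (p <= i * c + corner_x t)%N -> (q <= j * c + corner_y t)%N ->
  p = (i * c + corner_x t)%N /\ q = (j * c + corner_y t)%N.
Proof.
case=> t' [i' [j' [ek ip jq]]] pi qj.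
have cy s : (corner_y s < c)%N by case: s => /=; lia.
have := multiple_le (corner_x_lt t') (leq_trans ip pi) (corner_x_lt t).
have := multiple_le (cy t') (leq_trans jq qj) (cy t).
move: ek ip jq pi qj; case: t => /=; case: t' => /=; lia.
Qed.

End Staircase.

(** * The fiber cone of a symmetric ideal *)
Section SymmetricFiberCone.
Variables (K : fieldType) (a b c : nat).
Hypotheses (a_gt0 : (0 < a)%N) (lt_ab : (a < b)%N) (lt_bc : (b < c)%N).
Hypothesis le_c2a : (c <= 2 * a)%N.

Local Notation I := (symmetric_ideal K a b c).
Local Notation F := (fiber_cone I).
Local Notation stair := (staircase a b c).
Local Notation mon := (xy_mon K).

Definition sym_gens : seq (nat * nat) := [:: (c, 0); (b, a); (a, b); (0, c)]%N.

Lemma symmetric_ideal_span f :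
  I f <-> ideal_span (fun u => exists2 e, e \in sym_gens & u = mon e.1 e.2) f.
Proof.
have [cx cy] : mon c 0 = 'X_ord0 ^+ c /\ mon 0 c = 'X_ord_max ^+ c.
  by rewrite /xy_mon expr0 mulr1 mul1r.
split; apply: ideal_span_le; try exact: ideal_span_ideal.
  move=> u; rewrite !inE => ue; apply: sub_gen_smallest.
  case/or4P: ue => /eqP->; rewrite -?cx -?cy.
  - by exists (c, 0); rewrite ?mem_head.
  - by exists (b, a); rewrite // !inE eqxx orbT.
  - by exists (a, b); rewrite // !inE eqxx !orbT.
  - by exists (0, c); rewrite // !inE eqxx !orbT.
move=> u [[p q]]; rewrite !inE !xpair_eqE => pq ->.
apply: sub_gen_smallest; rewrite !inE.
by case/or4P: pq => /andP[/eqP-> /eqP->] /=; rewrite ?cx ?cy eqxx ?orbT.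
Qed.

Lemma sym_gen_mem p q : (p, q) \in sym_gens -> ideal_pow I 1 (mon p q).
Proof.
move=> pq; rewrite -[mon p q]mulr1; apply: ideal_mul_mem => //.
by apply/symmetric_ideal_span; apply: sub_gen_smallest; exists (p, q).
Qed.

Lemma ideal_pow_staircase k u : ideal_pow I k u -> supp_in (stair k) u.
Proof.
have idS n : is_ideal (supp_in (K := K) (stair n)).
  by apply: supp_in_ideal => *; apply: staircase_up.
elim: k u => [|k IH] u.
  by move=> _ v _; exists Power, 0%N, 0%N; split.
apply: ideal_span_le => // _ [v [w [Iv /IH Sw ->]]].
move/symmetric_ideal_span: Iv.
apply: (@ideal_span_le _ _ (fun v => supp_in (stair k.+1) (v * w)))
  => [|v' [[p q] pq ->]].
  have [S0 SD SM] := idS k.+1.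
  split=> [|x y Sx Sy|x y Sy]; first by rewrite mul0r.
    by rewrite mulrDl; apply: SD.
  by rewrite -mulrA; apply: SM.
apply: (@supp_inM _ (fun p' q' => (p', q') \in sym_gens)) Sw; last first.
  exact: supp_in_mon.
by move=> ? ? ? ? ?; apply: staircaseS.
Qed.

(** By minimality of the corners, a monomial of m I^k, which lies strictly above
    a point of the staircase, is never a corner. *)
Lemma mideal_corner0 t i j u :
  ideal_mul (max_ideal_xy K) (ideal_pow I (i + j + corner_deg t)) u ->
  u@_(xy_exp (i * c + corner_x a b t) (j * c + corner_y a b t)) = 0.
Proof.
set k := (i + j + _)%N => mu.
pose S p q := exists p' q',
  [/\ stair k p' q', p' <= p, q' <= q & p' + q' < p + q]%N.
apply: (@supp_in_coef0 _ S); last first.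
  case=> p [q [Spq pi qj]].
  have [-> ->] := corner_minimal a_gt0 lt_ab lt_bc le_c2a Spq pi qj.
  by rewrite ltnn.
apply: ideal_span_le mu => [|_ [v [w [+ + ->]]]].
  apply: supp_in_ideal => p q p' q' [x [y [Sxy xp yq xy]]].
  by exists x, y; split=> //; lia.
move=> /max_ideal_xy_supp mv /ideal_pow_staircase Iw.
apply: supp_inM mv Iw => p q p' q' pq Sp; exists p', q'; split=> //; lia.
Qed.

(** Such a monomial is a proper multiple of x^c y^c, which lies in I^2. *)
Lemma mon_deep p q : (c <= p)%N -> (c <= q)%N -> (2 * c < p + q)%N ->
  ideal_mul (max_ideal_xy K) (ideal_pow I 2) (mon p q).
Proof.
move=> cp cq cpq; rewrite -(subnK cp) -(subnK cq) -xy_monM.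
apply: ideal_mul_mem; first by apply: xy_mon_max_ideal; lia.
rewrite -[X in mon X _]addn0 -[X in mon _ X]add0n -xy_monM.
by apply: (@ideal_powD _ _ 1 1); apply: sym_gen_mem; rewrite !inE eqxx ?orbT.
Qed.

Definition corner_term t : rees I :=
  rees_term I (corner_deg t) (mon (corner_x a b t) (corner_y a b t)).

(** Sends the outer variable to x^c t and the inner one to y^c t. *)
Definition lift_plane : {rmorphism {poly {poly K}} -> rees I} :=
  peval (peval (@rees_const K I) (rees_term I 1 (mon 0 c)))
    (rees_term I 1 (mon c 0)).

Lemma corner_mem t :
  ideal_pow I (corner_deg t) (mon (corner_x a b t) (corner_y a b t)).
Proof. by case: t => //; apply: sym_gen_mem; rewrite !inE eqxx ?orbT. Qed.

Lemma lift_plane_corner g t :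
  lift_plane g * corner_term t =
  \sum_(i < size g) \sum_(j < size (g`_i)%R)
    rees_term I (i + j + corner_deg t)
      ((g`_i`_j)%:MP * mon (i * c + corner_x a b t) (j * c + corner_y a b t)).
Proof.
rewrite [lift_plane g](pevalE _ _ (leqnn _)) mulr_suml; apply: eq_bigr => i _.
rewrite /= (pevalE _ _ (leqnn _)) !mulr_suml; apply: eq_bigr => j _ /=.
have [Ix ->] := @rees_termX _ I 1 (mon c 0) i (sym_gen_mem (mem_head _ _)).
have gy : (0, c)%N \in sym_gens by rewrite !inE eqxx !orbT.
have [Iy ->] := @rees_termX _ I 1 (mon 0 c) j (sym_gen_mem gy).
rewrite muln1 in Ix *; rewrite muln1 in Iy *.
have It := corner_mem t.
have Ixy := ideal_powD Ix Iy; have Ixyt := ideal_powD Ixy It.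
rewrite /rees_const /corner_term -!mulrA [_ * (rees_term I i _ * _)]mulrA.
rewrite [_ * rees_term I i _]mulrC.
by rewrite !rees_termM // !xy_monX !xy_monM !muln0 addn0 !add0n.
Qed.

Lemma coef_lift_plane_corner g t k p q :
  (rees_val (lift_plane g * corner_term t))`_k@_(xy_exp p q) =
  \sum_(i < size g) \sum_(j < size (g`_i)%R)
    g`_i`_j * [&& (i + j + corner_deg t == k)%N, (i * c + corner_x a b t == p)%N
      & (j * c + corner_y a b t == q)%N]%:R.
Proof.
rewrite lift_plane_corner -[rees_val _]/(val _) rmorph_sum coef_sum raddf_sum.
apply: eq_bigr => i _; rewrite rmorph_sum coef_sum raddf_sum.
apply: eq_bigr => j _ /=.
have It : ideal_pow I (i + j + corner_deg t)
    ((g`_i`_j)%:MP * mon (i * c + corner_x a b t) (j * c + corner_y a b t)).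
  have [_ _] := ideal_pow_ideal I (i + j + corner_deg t); apply.
  have Ix := (@rees_termX _ I 1 (mon c 0) i (sym_gen_mem (mem_head _ _))).1.
  have gy : (0, c)%N \in sym_gens by rewrite !inE eqxx !orbT.
  have Iy := (@rees_termX _ I 1 (mon 0 c) j (sym_gen_mem gy)).1.
  rewrite muln1 in Ix; rewrite muln1 in Iy.
  have := ideal_powD (ideal_powD Ix Iy) (corner_mem t).
  by rewrite !xy_monX !xy_monM !muln0 addn0 add0n.
rewrite rees_termE // coefZ coefXn eq_sym; case: eqP => _ /=.
  by rewrite mulr1 mcoeffCM mcoeff_xy_mon.
by rewrite mulr0 mcoeff0 mulr0.
Qed.

Lemma coef_same_corner g t i j :
  (rees_val (lift_plane g * corner_term t))`_(i + j + corner_deg t)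
    @_(xy_exp (i * c + corner_x a b t) (j * c + corner_y a b t)) = g`_i`_j.
Proof.
have c_gt0 : (0 < c)%N by lia.
rewrite coef_lift_plane_corner.
have eqE i' j' : [&& (i' + j' + corner_deg t == i + j + corner_deg t)%N,
    (i' * c + corner_x a b t == i * c + corner_x a b t)%N
    & (j' * c + corner_y a b t == j * c + corner_y a b t)%N] = (i' == i) && (j' == j).
  rewrite !eqn_add2r !eqn_mul2r eqn0Ngt c_gt0 /=.
  by case: (eqVneq i' i) => [->|]; rewrite ?eqn_add2l ?andbb ?andbF.
case: (ltnP i (size g)) => [ig|gi]; last first.
  rewrite [g`_i]nth_default // coef0 big1 // => i' _; rewrite big1 // => j' _.
  by rewrite eqE (ltn_eqF (leq_trans (ltn_ord i') gi)) mulr0.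
rewrite (bigD1 (Ordinal ig)) //= [X in _ + X]big1 ?addr0 => [|i' ne_i]; last first.
  rewrite big1 // => j' _; rewrite eqE; move: ne_i.
  by rewrite -val_eqE /= => /negPf->; rewrite mulr0.
case: (ltnP j (size (g`_i)%R)) => [jg|gj]; last first.
  rewrite [g`_i`_j]nth_default // big1 // => j' _.
  by rewrite eqE (ltn_eqF (leq_trans (ltn_ord j') gj)) andbF mulr0.
rewrite (bigD1 (Ordinal jg)) //= [X in _ + X]big1 ?addr0 => [|j' ne_j]; last first.
  rewrite eqE; move: ne_j.
  by rewrite -val_eqE /= => /negPf->; rewrite andbF mulr0.
by rewrite eqE !eqxx mulr1.
Qed.

(** The x-exponent modulo c determines the type of a corner. *)
Lemma coef_other_corner g t t' k i q : t <> t' ->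
  (rees_val (lift_plane g * corner_term t'))`_k
    @_(xy_exp (i * c + corner_x a b t) q) = 0.
Proof.
move=> ne_t; rewrite coef_lift_plane_corner big1 // => i' _; rewrite big1 // => j' _.
have xc s : (corner_x a b s < c)%N by exact: corner_x_lt.
have -> : (i' * c + corner_x a b t' == i * c + corner_x a b t)%N = false.
  apply/negP => /eqP/(congr1 (modn^~ c)); rewrite !modnMDl !modn_small //.
  by move: ne_t; case: t; case: t' => //=; lia.
by rewrite andbF mulr0.
Qed.

(** The coefficient of such an element at the corner of type t and indices i, j
    is exactly the coefficient of g t at i, j, and it vanishes on m I^k. *)
Lemma corners_free (g : corner_type -> {poly {poly K}}) :
  fiber_pi I (lift_plane (g Power) * corner_term Power +
    lift_plane (g XHeavy) * corner_term XHeavy +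
    lift_plane (g YHeavy) * corner_term YHeavy) = 0 -> forall t, g t = 0.
Proof.
move=> /fiber_pi_eq0 mr t; apply/polyP => i; apply/polyP => j; rewrite !coef0.
have := mideal_corner0 (mr (i + j + corner_deg t)%N).
rewrite -[rees_val _]/(val _) !rmorphD !coefD !mcoeffD /=.
by case: t; rewrite coef_same_corner !coef_other_corner ?addr0 ?add0r.
Qed.

Definition plane_map : {rmorphism {poly {poly K}} -> F} := fiber_pi I \o lift_plane.

Definition corner_class t : F := fiber_pi I (corner_term t).

Lemma corner_class_mul t t' : t <> Power -> t' <> Power ->
  corner_class t * corner_class t' = 0.
Proof.
move=> tP t'P; rewrite -rmorphM rees_termM; try exact: corner_mem.
rewrite xy_monM.
have -> : (corner_deg t + corner_deg t' = 2)%N.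
  by move: tP t'P; case: t; case: t'.
apply: fiber_term_eq0; apply: mon_deep;
  by case: t tP => // _; case: t' t'P => // _ /=; lia.
Qed.

(** These combinations form a subring, because products of two middle classes
    vanish, and they contain the classes of the four generators. *)
Lemma corners_span r : exists g0 g1 g2,
  r = plane_map g0 + plane_map g1 * corner_class XHeavy +
    plane_map g2 * corner_class YHeavy.
Proof.
set e1 := corner_class XHeavy; set e2 := corner_class YHeavy.
pose B : set F := fun r =>
  exists g0 g1 g2, r = plane_map g0 + plane_map g1 * e1 + plane_map g2 * e2.
apply: (fiber_cone_generated (B := B) symmetric_ideal_span) r.
- move=> _ _ [g0 [g1 [g2 ->]]] [h0 [h1 [h2 ->]]].
  by exists (g0 + h0), (g1 + h1), (g2 + h2); rewrite !rmorphD; ring.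
- have [e11 e12 e22] : [/\ e1 * e1 = 0, e1 * e2 = 0 & e2 * e2 = 0].
    by split; apply: corner_class_mul.
  move=> _ _ [g0 [g1 [g2 ->]]] [h0 [h1 [h2 ->]]].
  exists (g0 * h0), (g0 * h1 + g1 * h0), (g0 * h2 + g2 * h0).
  rewrite !(rmorphD, rmorphM).
  ring: e11 e12 e22.
- move=> e; exists e%:P%:P, 0, 0; rewrite rmorph0 !mul0r !addr0.
  by rewrite /plane_map /= pevalC /= pevalC.
move=> _ [[p q] pq ->] /=; move: pq; rewrite !inE !xpair_eqE.
case/or4P=> /andP[/eqP-> /eqP->].
- by exists 'X, 0, 0; rewrite rmorph0 !mul0r !addr0 /= pevalX.
- by exists 0, 1, 0; rewrite rmorph0 rmorph1 mul0r mul1r add0r addr0.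
- by exists 0, 0, 1; rewrite rmorph0 rmorph1 mul0r mul1r !add0r.
- by exists 'Y, 0, 0; rewrite rmorph0 !mul0r !addr0 /= pevalC /= pevalX.
Qed.

Theorem symmetric_fiber_cone_cohen_macaulay :
  graded_cohen_macaulay (@fiber_cone_max K I).
Proof.
have gx : (c, 0)%N \in sym_gens by rewrite mem_head.
have gy : (0, c)%N \in sym_gens by rewrite !inE eqxx !orbT.
apply: (free_square_zero_cohen_macaulay corners_span);
  try exact: corner_class_mul.
- move=> g0 g1 g2 e0.
  pose g t := match t with Power => g0 | XHeavy => g1 | YHeavy => g2 end.
  have g_eq0 : forall t, g t = 0.
    apply: corners_free; rewrite -e0 !(rmorphD, rmorphM) /=.
    have -> : corner_term Power = 1.
      by rewrite -(rees_term1 I) /corner_term /xy_mon /= !expr0 mulr1.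
    by rewrite rmorph1 mulr1.
  by split; [apply: (g_eq0 Power)|apply: (g_eq0 XHeavy)|apply: (g_eq0 YHeavy)].
- exists (rees_term I 1 (mon c 0)); split; last by rewrite /= pevalX.
  by rewrite rees_termE ?coefZ ?coefX ?mulr0 //; apply: sym_gen_mem.
- exists (rees_term I 1 (mon 0 c)); split; last by rewrite /= pevalC /= pevalX.
  by rewrite rees_termE ?coefZ ?coefX ?mulr0 //; apply: sym_gen_mem.
Qed.

End SymmetricFiberCone.

Local Close Scope ring_scope.

Theorem corollary3p6 (K : fieldType) (a b c m : nat) :
  0 < a -> a < b -> b < c -> c <= m + 2 * a ->
  graded_cohen_macaulay
    (@fiber_cone_max K
      (symmetric_ideal K (a + m) (b + m) (c + m))).
Proof.
move=> a_gt0 lt_ab lt_bc le_c.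
by apply: symmetric_fiber_cone_cohen_macaulay; lia.
Qed.
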